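(* Let $R$ be a commutative ring with $1$. For any $R$-module $M$, the sequence of $R$-modules, natural in $M$, $$0\to K(M)\xrightarrow{\ \varphi\ } P^2_R(M)\xrightarrow{\ \varepsilon\ } M\to 0$$ is exact. More precisely, the set $K(M)\times M$ with the operations $$(k,x)+(k',y)=(k+k'-\theta_1(xy),\,x+y),\qquad r\cdot(k,x)=\bigl(rk-\theta_2((r^2-r)\otimes\gamma_2(x)),\,rx\bigr)$$ ($k,k'\in K(M)$, $x,y\in M$, $r\in R$) is an $R$-module, and the assignment $p(x)\mapsto(0,x)$ defines an $R$-linear isomorphism from $P^2_R(M)$ onto this $R$-module.
   Context: $R$ is a commutative ring with $1$; $\otimes$ means $\otimes_R$. $P^2_R(M)$ is the $R$-module generated by elements $p(x)$, $x\in M$, subject to the relations, for $x,y,z\in M$, $r,s\in R$: $p(x+y+z)-p(x+y)-p(y+z)-p(x+z)+p(x)+p(y)+p(z)=0$; $p(rx+sy)-p(rx)-p(sy)-rs\,p(x+y)+rs\,p(x)+rs\,p(y)=0$; $p(rsx)-r^2p(sx)-s\,p(rx)+r^2s\,p(x)=0$. The map $\varepsilon:P^2_R(M)\to M$ is the $R$-linear map with $\varepsilon(p(x))=x$. $I_2$ is the ideal of $R$ generated by the elements $r^2-r$, $r\in R$ (so $2=2^2-2\in I_2$). $\mathrm{Sym}^2_R(M)$ is the symmetric tensor square, with generators $xy$. $\Gamma^2_R(M)$ is the degree $2$ component of the divided power algebra over $M$: the $R$-module generated by $\gamma_2(x)$ and symbols $\gamma_1(x)\gamma_1(y)$, $R$-bilinear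 in $x,y\in M$, with relations $\gamma_2(x+y)=\gamma_2(x)+\gamma_2(y)+\gamma_1(x)\gamma_1(y)$ and $\gamma_2(rx)=r^2\gamma_2(x)$. Let $w:\mathrm{Sym}^2_R(M)\to\Gamma^2_R(M)$ be the $R$-linear map $w(xy)=\gamma_1(x)\gamma_1(y)$. Consider the (well-defined) $R$-linear maps $j_{11}:I_2\otimes\mathrm{Sym}^2_R(M)\to\mathrm{Sym}^2_R(M)$, $j_{11}(a\otimes xy)=a\,xy$; $j_{12}:\Gamma^2_R(M)\to\mathrm{Sym}^2_R(M)$, $j_{12}(\gamma_2(x))=x^2$; $j_{21}=\mathrm{Id}\otimes w:I_2\otimes\mathrm{Sym}^2_R(M)\to I_2\otimes\Gamma^2_R(M)$; $j_{22}:\Gamma^2_R(M)\to I_2\otimes\Gamma^2_R(M)$, $j_{22}(\gamma_2(x))=2\otimes\gamma_2(x)$. $K(M)$ is the pushout of $$\mathrm{Sym}^2_R(M)\xleftarrow{(j_{11},j_{12})}(I_2\otimes\mathrm{Sym}^2_R(M))\oplus\Gamma^2_R(M)\xrightarrow{(j_{21},j_{22})}I_2\otimes\Gamma^2_R(M),$$ with structure maps $\theta_1:\mathrm{Sym}^2_R(M)\to K(M)$ and $\theta_2:I_2\otimes\Gamma^2_R(M)\to K(M)$. The $R$-linear maps $\varphi_1:\mathrm{Sym}^2_R(M)\to P^2_R(M)$, $\varphi_1(xy)=p(x+y)-p(x)-p(y)$, and $\varphi_2:I_2\otimes\Gamma^2_R(M)\to P^2_R(M)$, $\varphi_2((r^2-r)\otimes\gamma_2(x))=p(rx)-r\,p(x)$,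 are well defined and satisfy $\varphi_1j_{11}=\varphi_2j_{21}$, $\varphi_1j_{12}=\varphi_2j_{22}$; $\varphi:K(M)\to P^2_R(M)$ is the induced map, with $\varphi\theta_1=\varphi_1$, $\varphi\theta_2=\varphi_2$. *)

(* Defs.v *)
From HB Require Import structures.
From mathcomp Require Import all_boot all_order all_algebra.
From mathcomp Require Import boolp.
From mathcomp Require Import ring.

Set Implicit Arguments.
Unset Strict Implicit.
Unset Printing Implicit Defensive.

Import GRing.Theory.
Local Open Scope ring_scope.
Local Open Scope quotient_scope.

(* Modules presented by generators and relations.  Rings are not assumed to  *)
(* be nontrivial (pzRingType / comPzRingType), hence {malg R[K]}, which is   *)
(* restricted to nontrivial rings, is not available as a free module.  The   *)
(* presented module is the set of formal R-linear expressions in the         *)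
(* generators modulo the least congruence containing the module axioms and   *)
(* the given relations; pres_lift and pres_ext below are its universal       *)
(* property.                                                                 *)

Inductive mexpr (R X : Type) : Type :=
| MGen of X
| MZero
| MOpp of mexpr R X
| MAdd of mexpr R X & mexpr R X
| MScale of R & mexpr R X.

Arguments MGen {R X} x%_R.
Arguments MZero {R X}.

HB.instance Definition _ (R X : Type) := gen_eqMixin (mexpr R X).
HB.instance Definition _ (R X : Type) := gen_choiceMixin (mexpr R X).

Declare Scope mexpr_scope.
Delimit Scope mexpr_scope with ME.
Bind Scope mexpr_scope with mexpr.
Notation "0" := MZero : mexpr_scope.
Notation "- a" := (MOpp a) : mexpr_scope.
Notation "a + b" := (MAdd a b) : mexpr_scope.
Notation "a - b" := (MAdd a (MOpp b)) : mexpr_scope.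
Notation "r *: a" := (MScale r%R a) : mexpr_scope.

Section Congruence.
Local Open Scope mexpr_scope.
Context (R : pzRingType) (X : Type) (rel : mexpr R X -> mexpr R X -> Prop).

Inductive mcong : mexpr R X -> mexpr R X -> Prop :=
| mcong_rel a b : rel a b -> mcong a b
| mcong_refl a : mcong a a
| mcong_sym a b : mcong a b -> mcong b a
| mcong_trans b a c : mcong a b -> mcong b c -> mcong a c
| mcong_opp a a' : mcong a a' -> mcong (- a) (- a')
| mcong_add a a' b b' : mcong a a' -> mcong b b' -> mcong (a + b) (a' + b')
| mcong_scale r a a' : mcong a a' -> mcong (r *: a) (r *: a')
| mcong_addA a b c : mcong (a + (b + c)) ((a + b) + c)
| mcong_addC a b : mcong (a + b) (b + a)
| mcong_add0 a : mcong (0 + a) a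
| mcong_addN a : mcong ((- a) + a) 0
| mcong_scaleA r s a : mcong (r *: (s *: a)) ((r * s) *: a)
| mcong_scale1 a : mcong (1 *: a) a
| mcong_scaleDr r a b : mcong (r *: (a + b)) (r *: a + r *: b)
| mcong_scaleDl a r s : mcong ((r + s) *: a) (r *: a + s *: a).

End Congruence.

Section Presentation.
Context (R : pzRingType) (X : Type) (rel : mexpr R X -> mexpr R X -> Prop).

Definition mcongb (a b : mexpr R X) : bool := `[< mcong rel a b >].

Lemma mcongb_refl : reflexive mcongb.
Proof. by move=> a; apply/asboolP; apply: mcong_refl. Qed.

Lemma mcongb_sym : symmetric mcongb.
Proof. by move=> a b; apply/asboolP/asboolP; apply: mcong_sym. Qed.

Lemma mcongb_trans : transitive mcongb.
Proof.
move=> b a c /asboolP ab /asboolP bc; apply/asboolP.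
exact: mcong_trans ab bc.
Qed.

Canonical mcongb_equiv := EquivRel mcongb mcongb_refl mcongb_sym mcongb_trans.

Definition pres := {eq_quot mcongb_equiv}.

HB.instance Definition _ := Choice.on pres.
HB.instance Definition _ := Quotient.on pres.

Lemma pres_eq (a b : mexpr R X) : mcong rel a b <-> \pi_pres a = \pi_pres b.
Proof.
split=> [ab|/eqmodP/asboolP//].
by apply/eqmodP; apply/asboolP.
Qed.

Lemma pres_repr (a : mexpr R X) : mcong rel (repr (\pi_pres a)) a.
Proof. by apply/pres_eq; rewrite reprK. Qed.

Definition pres_zero : pres := \pi_pres MZero.
Definition pres_opp (u : pres) : pres := \pi_pres (MOpp (repr u)).
Definition pres_add (u v : pres) : pres := \pi_pres (MAdd (repr u) (repr v)).
Definition pres_scale (r : R) (u : pres) : pres := \pi_pres (MScale r (repr u)).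

Lemma pres_oppE a : pres_opp (\pi_pres a) = \pi_pres (MOpp a).
Proof. by apply/pres_eq/mcong_opp/pres_repr. Qed.

Lemma pres_addE a b :
  pres_add (\pi_pres a) (\pi_pres b) = \pi_pres (MAdd a b).
Proof. by apply/pres_eq/mcong_add; apply: pres_repr. Qed.

Lemma pres_scaleE r a : pres_scale r (\pi_pres a) = \pi_pres (MScale r a).
Proof. by apply/pres_eq/mcong_scale/pres_repr. Qed.

Lemma pres_addA : associative pres_add.
Proof.
move=> u v w; rewrite -[u]reprK -[v]reprK -[w]reprK.
rewrite (pres_addE (repr v)) (pres_addE (repr u)) (pres_addE (repr u)) pres_addE.
by apply/pres_eq; apply: mcong_addA.
Qed.

Lemma pres_addC : commutative pres_add.
Proof.
by move=> u v; rewrite -[u]reprK -[v]reprK !pres_addE; apply/pres_eq; apply: mcong_addC.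
Qed.

Lemma pres_add0 : left_id pres_zero pres_add.
Proof. by move=> u; rewrite -[u]reprK pres_addE; apply/pres_eq; apply: mcong_add0. Qed.

Lemma pres_addN : left_inverse pres_zero pres_opp pres_add.
Proof.
move=> u; rewrite -[u]reprK (pres_oppE (repr u)) (pres_addE _ (repr u)).
by apply/pres_eq; apply: mcong_addN.
Qed.

HB.instance Definition _ :=
  GRing.isZmodule.Build pres pres_addA pres_addC pres_add0 pres_addN.

Lemma pres_scaleA r s u :
  pres_scale r (pres_scale s u) = pres_scale (r * s) u.
Proof. rewrite -[u]reprK (pres_scaleE s (repr u)) !(pres_scaleE _ (MScale _ _)).
by rewrite (pres_scaleE _ (repr u)); apply/pres_eq; apply: mcong_scaleA. Qed.

Lemma pres_scale1 : left_id 1 pres_scale.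
Proof. by move=> u; rewrite -[u]reprK pres_scaleE; apply/pres_eq; apply: mcong_scale1. Qed.

Lemma pres_scaleDr : right_distributive pres_scale +%R.
Proof.
move=> r u v; rewrite -[u]reprK -[v]reprK.
rewrite -[LHS]/(pres_scale r (pres_add _ _)) -[RHS]/(pres_add _ _).
by rewrite !(pres_addE, pres_scaleE); apply/pres_eq; apply: mcong_scaleDr.
Qed.

Lemma pres_scaleDl u : {morph pres_scale^~ u : r s / r + s}.
Proof.
move=> r s /=; rewrite -[u]reprK -[RHS]/(pres_add _ _).
rewrite !(pres_scaleE _ (repr u)) pres_addE.
by apply/pres_eq; apply: mcong_scaleDl.
Qed.

HB.instance Definition _ := GRing.Zmodule_isLmodule.Build R pres
  pres_scaleA pres_scale1 pres_scaleDr pres_scaleDl.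

Definition pres_gen (x : X) : pres := \pi_pres (MGen x).

Section Lift.
Context (V : lmodType R) (f : X -> V).

Fixpoint meval (a : mexpr R X) : V :=
  match a with
  | MGen x => f x
  | MZero => 0
  | MOpp a => - meval a
  | MAdd a b => meval a + meval b
  | MScale r a => r *: meval a
  end.

Context (f_rel : forall a b, rel a b -> meval a = meval b).

Lemma meval_cong a b : mcong rel a b -> meval a = meval b.
Proof.
elim=> {a b} //=.
- by move=> b a c _ -> _ ->.
- by move=> a a' _ ->.
- by move=> a a' b b' _ -> _ ->.
- by move=> r a a' _ ->.
- by move=> a b c; rewrite addrA.
- by move=> a b; rewrite addrC.
- by move=> a; rewrite add0r.
- by move=> a; rewrite addNr.
- by move=> r s a; rewrite scalerA.
- by move=> a; rewrite scale1r.
- by move=> r a b; rewrite scalerDr.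
- by move=> a r s; rewrite scalerDl.
Qed.

Definition pres_lift_fun (u : pres) : V := meval (repr u).

Lemma pres_lift_pi a : pres_lift_fun (\pi_pres a) = meval a.
Proof. exact/meval_cong/pres_repr. Qed.

Lemma pres_lift_linear : linear pres_lift_fun.
Proof.
move=> r u v; rewrite -[u]reprK -[v]reprK.
rewrite -[X in pres_lift_fun X]/(pres_add (pres_scale r _) _).
by rewrite pres_scaleE pres_addE !pres_lift_pi.
Qed.

HB.instance Definition _ :=
  GRing.isLinear.Build R pres V *:%R pres_lift_fun pres_lift_linear.

(* locked: simplification would otherwise unfold every bundled linear map. *)
Definition pres_lift : {linear pres -> V} :=
  locked (pres_lift_fun : {linear pres -> V}).

Lemma pres_liftE x : pres_lift (pres_gen x) = f x.
Proof. by rewrite /pres_lift -lock [LHS]pres_lift_pi. Qed.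

End Lift.

Lemma meval_gen a : meval pres_gen a = \pi_pres a.
Proof.
elim: a => [x||a IH|a IHa b IHb|r a IH] //=.
- by rewrite IH -[LHS]/(pres_opp _) pres_oppE.
- by rewrite IHa IHb -[LHS]/(pres_add _ _) pres_addE.
- by rewrite IH -[LHS]/(pres_scale _ _) pres_scaleE.
Qed.

Lemma pres_relE a b : rel a b -> meval pres_gen a = meval pres_gen b.
Proof. by move=> ab; rewrite !meval_gen; apply/pres_eq/mcong_rel. Qed.

Lemma pres_ext (V : lmodType R) (f g : {linear pres -> V}) :
  (forall x, f (pres_gen x) = g (pres_gen x)) -> f =1 g.
Proof.
move=> fg u; rewrite -[u]reprK -meval_gen.
elim: (repr u) => [x||a IH|a IHa b IHb|r a IH] /=; first exact: fg.
- by rewrite !linear0.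
- by rewrite !linearN IH.
- by rewrite !linearD IHa IHb.
- by rewrite !linearZ IH.
Qed.

End Presentation.

(* lmod_ring proves equations between R-linear combinations in an R-module   *)
(* by comparing coefficients with ring.                                      *)

Section LmodRing.
Context (R : comPzRingType) (V : lmodType R).

Fixpoint mcoef (a : mexpr R nat) (i : nat) : R :=
  match a with
  | MGen n => (n == i)%:R
  | MZero => 0
  | MOpp a => - mcoef a i
  | MAdd a b => mcoef a i + mcoef b i
  | MScale r a => r * mcoef a i
  end.

Lemma meval_nth (vs : seq V) (a : mexpr R nat) :
  meval (nth 0 vs) a = \sum_(i < size vs) mcoef a i *: nth 0 vs i.
Proof.
elim: a => [n||a IH|a IHa b IHb|r a IH] /=.
- case: (ltnP n (size vs)) => [lt_n|le_n].
    rewrite (bigD1 (Ordinal lt_n)) //= eqxx scale1r big1 ?addr0 // => i ne_i.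
    rewrite (_ : n == i = false) ?scale0r //.
    by apply: contra_neqF ne_i => /eqP n_i; apply/val_inj.
  rewrite nth_default // big1 // => i _.
  by rewrite gtn_eqF ?scale0r // (leq_trans (ltn_ord i)).
- by rewrite big1 // => i _; rewrite scale0r.
- by rewrite IH -sumrN; apply: eq_bigr => i _; rewrite scaleNr.
- by rewrite IHa IHb -big_split; apply: eq_bigr => i _; rewrite scalerDl.
- by rewrite IH scaler_sumr; apply: eq_bigr => i _; rewrite scalerA.
Qed.

Lemma lmod_ring_correct (vs : seq V) (a b : mexpr R nat) :
  foldr (fun i P => mcoef a i = mcoef b i /\ P) True (iota 0 (size vs)) ->
  meval (nth 0 vs) a = meval (nth 0 vs) b.
Proof.
move=> ab; rewrite !meval_nth; apply: eq_bigr => i _; congr (_ *: _).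
have: nat_of_ord i \in iota 0 (size vs) by rewrite mem_iota /=.
elim: (iota 0 (size vs)) ab => //= j s IH [abj abs].
by rewrite inE => /orP[/eqP ->|/(IH abs)].
Qed.

End LmodRing.

(* Atoms are compared up to conversion, because the same operation may occur *)
(* with different canonical structure paths.                                 *)
Ltac lmod_add x l :=
  match l with
  | nil => constr:(cons x nil)
  | cons ?y _ => let _ := match constr:(Set) with _ => unify x y end in l
  | cons ?y ?l' => let l'' := lmod_add x l' in constr:(cons y l'')
  end.

Ltac lmod_index x l :=
  match l with
  | cons ?y _ =>
    let _ := match constr:(Set) with _ => unify x y end in constr:(0%N)
  | cons _ ?l' => let n := lmod_index x l' in constr:(S n)
  end.

Ltac lmod_atoms t l :=
  lazymatch t with
  | @GRing.add _ ?a ?b => let l' := lmod_atoms a l in lmod_atoms b l'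
  | @GRing.opp _ ?a => lmod_atoms a l
  | @GRing.scale _ _ _ ?a => lmod_atoms a l
  | @GRing.zero _ => l
  | _ => lmod_add t l
  end.

Ltac lmod_reify R t l :=
  lazymatch t with
  | @GRing.add _ ?a ?b =>
    let a' := lmod_reify R a l in let b' := lmod_reify R b l in
    constr:(@MAdd R nat a' b')
  | @GRing.opp _ ?a => let a' := lmod_reify R a l in constr:(@MOpp R nat a')
  | @GRing.scale _ _ ?r ?a =>
    let a' := lmod_reify R a l in constr:(@MScale R nat r a')
  | @GRing.zero _ => constr:(@MZero R nat)
  | _ => let n := lmod_index t l in constr:(@MGen R nat n)
  end.

Ltac lmod_ring R :=
  rewrite ?mulr2n;
  lazymatch goal with
  | |- @eq ?V ?a ?b =>
    let l := lmod_atoms a (@nil V) in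
    let l := lmod_atoms b l in
    let a' := lmod_reify (GRing.ComPzRing.sort R) a l in
    let b' := lmod_reify (GRing.ComPzRing.sort R) b l in
    apply: (@lmod_ring_correct R _ l a' b'); rewrite /=;
    repeat split; ring
  end.


Section UnbundledLinear.
Context (R : pzRingType) (U V : lmodType R) (f : U -> V) (f_lin : linear f).

Lemma linear_morphD x y : f (x + y) = f x + f y.
Proof. by have := f_lin 1 x y; rewrite !scale1r. Qed.

Lemma linear_morphZ r x : f (r *: x) = r *: f x.
Proof.
have f0 : f 0 = 0 by apply: (addrI (f 0)); rewrite -linear_morphD !addr0.
by have := f_lin r x 0; rewrite f0 !addr0.
Qed.

End UnbundledLinear.

Section Tensor.
Context (R : comPzRingType) (A B : lmodType R).

Inductive tens_rel : mexpr R (A * B) -> mexpr R (A * B) -> Prop :=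
| tens_relDl a a' b :
    tens_rel (MGen (a + a', b)) (MGen (a, b) + MGen (a', b))
| tens_relZl r a b : tens_rel (MGen (r *: a, b)) (r *: MGen (a, b))
| tens_relDr a b b' :
    tens_rel (MGen (a, b + b')) (MGen (a, b) + MGen (a, b'))
| tens_relZr r a b : tens_rel (MGen (a, r *: b)) (r *: MGen (a, b)).

Definition tens := pres tens_rel.
HB.instance Definition _ := GRing.Lmodule.on tens.

Definition tensor (a : A) (b : B) : tens := pres_gen tens_rel (a, b).

Lemma tensor_linearl b : linear (tensor^~ b).
Proof.
move=> r a a'; apply: etrans (pres_relE (tens_relDl _ _ _)) _.
by congr (_ + _); apply: (pres_relE (tens_relZl _ _ _)).
Qed.

Lemma tensor_linearr a : linear (tensor a).
Proof.
move=> r b b'; apply: etrans (pres_relE (tens_relDr _ _ _)) _.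
by congr (_ + _); apply: (pres_relE (tens_relZr _ _ _)).
Qed.

Section Lift.
Context (V : lmodType R) (f : A -> B -> V).
Context (f_linearl : forall b, linear (f^~ b)).
Context (f_linearr : forall a, linear (f a)).

Lemma tens_lift_rel a b : tens_rel a b ->
  meval (fun u => f u.1 u.2) a = meval (fun u => f u.1 u.2) b.
Proof.
case=> [x y z|r x y|x y z|r x y] /=.
- exact: (linear_morphD (f_linearl z)).
- exact: (linear_morphZ (f_linearl y)).
- exact: (linear_morphD (f_linearr x)).
- exact: (linear_morphZ (f_linearr x)).
Qed.

Definition tens_lift : {linear tens -> V} := pres_lift tens_lift_rel.

Lemma tens_liftE a b : tens_lift (tensor a b) = f a b.
Proof. exact: pres_liftE. Qed.

End Lift.

Lemma tens_ext (V : lmodType R) (f g : {linear tens -> V}) :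
  (forall a b, f (tensor a b) = g (tensor a b)) -> f =1 g.
Proof. by move=> fg; apply: pres_ext => -[a b]; apply: fg. Qed.

End Tensor.

Section TensorMap.
Context (R : comPzRingType) (A A' B B' : lmodType R).
Context (f : {linear A -> A'}) (g : {linear B -> B'}).

Lemma tens_map_linearl b : linear (fun a => tensor (f a) (g b)).
Proof. by move=> r a a'; rewrite linearP; apply: tensor_linearl. Qed.

Lemma tens_map_linearr a : linear (fun b => tensor (f a) (g b)).
Proof. by move=> r b b'; rewrite linearP; apply: tensor_linearr. Qed.

Definition tens_map : {linear tens A B -> tens A' B'} :=
  tens_lift tens_map_linearl tens_map_linearr.

Lemma tens_mapE a b : tens_map (tensor a b) = tensor (f a) (g b).
Proof. exact: tens_liftE. Qed.

End TensorMap.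

Section Pushout.
Context (R : comPzRingType) (A B C : lmodType R).
Context (f : {linear A -> B}) (g : {linear A -> C}).

Inductive pushout_rel : mexpr R (B + C) -> mexpr R (B + C) -> Prop :=
| pushout_relDl b b' :
    pushout_rel (MGen (inl (b + b'))) (MGen (inl b) + MGen (inl b'))
| pushout_relZl r b :
    pushout_rel (MGen (inl (r *: b))) (r *: MGen (inl b))
| pushout_relDr c c' :
    pushout_rel (MGen (inr (c + c'))) (MGen (inr c) + MGen (inr c'))
| pushout_relZr r c :
    pushout_rel (MGen (inr (r *: c))) (r *: MGen (inr c))
| pushout_rel_glue a : pushout_rel (MGen (inl (f a))) (MGen (inr (g a))).

Definition pushout := pres pushout_rel.
HB.instance Definition _ := GRing.Lmodule.on pushout.

Definition pushout_inl_fun (b : B) : pushout := pres_gen pushout_rel (inl b).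
Definition pushout_inr_fun (c : C) : pushout := pres_gen pushout_rel (inr c).

Lemma pushout_inl_linear : linear pushout_inl_fun.
Proof.
move=> r b b'; apply: etrans (pres_relE (pushout_relDl _ _)) _.
by congr (_ + _); apply: (pres_relE (pushout_relZl _ _)).
Qed.

Lemma pushout_inr_linear : linear pushout_inr_fun.
Proof.
move=> r c c'; apply: etrans (pres_relE (pushout_relDr _ _)) _.
by congr (_ + _); apply: (pres_relE (pushout_relZr _ _)).
Qed.

HB.instance Definition _ :=
  GRing.isLinear.Build R B pushout *:%R pushout_inl_fun pushout_inl_linear.
HB.instance Definition _ :=
  GRing.isLinear.Build R C pushout *:%R pushout_inr_fun pushout_inr_linear.

Definition pushout_inl : {linear B -> pushout} :=
  locked (pushout_inl_fun : {linear B -> pushout}).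
Definition pushout_inr : {linear C -> pushout} :=
  locked (pushout_inr_fun : {linear C -> pushout}).

Lemma pushout_glue a : pushout_inl (f a) = pushout_inr (g a).
Proof.
rewrite /pushout_inl /pushout_inr -!lock.
exact: (pres_relE (pushout_rel_glue a)).
Qed.

Section Lift.
Context (V : lmodType R) (h : {linear B -> V}) (k : {linear C -> V}).
Context (hk : forall a, h (f a) = k (g a)).

Definition pushout_gen_map (u : B + C) : V :=
  match u with inl b => h b | inr c => k c end.

Lemma pushout_lift_rel a b : pushout_rel a b ->
  meval pushout_gen_map a = meval pushout_gen_map b.
Proof. by case=> * /=; rewrite ?linearD ?linearZ ?hk. Qed.

Definition pushout_lift : {linear pushout -> V} := pres_lift pushout_lift_rel.

Lemma pushout_lift_inl b : pushout_lift (pushout_inl b) = h b.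
Proof. by rewrite /pushout_inl -lock [LHS]pres_liftE. Qed.

Lemma pushout_lift_inr c : pushout_lift (pushout_inr c) = k c.
Proof. by rewrite /pushout_inr -lock [LHS]pres_liftE. Qed.

End Lift.

Lemma pushout_ext (V : lmodType R) (h k : {linear pushout -> V}) :
  (forall b, h (pushout_inl b) = k (pushout_inl b)) ->
  (forall c, h (pushout_inr c) = k (pushout_inr c)) -> h =1 k.
Proof.
rewrite /pushout_inl /pushout_inr -!lock => hkl hkr.
by apply: pres_ext => -[b|c]; [apply: hkl|apply: hkr].
Qed.

End Pushout.

Section Sym2.
Context (R : comPzRingType) (M : lmodType R).

Inductive Sym2_rel : mexpr R (M * M) -> mexpr R (M * M) -> Prop :=
| Sym2_relD x x' y :
    Sym2_rel (MGen (x + x', y)) (MGen (x, y) + MGen (x', y))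
| Sym2_relZ r x y : Sym2_rel (MGen (r *: x, y)) (r *: MGen (x, y))
| Sym2_relC x y : Sym2_rel (MGen (x, y)) (MGen (y, x)).

Definition Sym2 := pres Sym2_rel.
HB.instance Definition _ := GRing.Lmodule.on Sym2.

Definition sym2 (x y : M) : Sym2 := pres_gen Sym2_rel (x, y).

Lemma sym2C x y : sym2 x y = sym2 y x.
Proof. exact: (pres_relE (Sym2_relC x y)). Qed.

Lemma sym2_linearl y : linear (sym2^~ y).
Proof.
move=> r x x'; apply: etrans (pres_relE (Sym2_relD _ _ _)) _.
by congr (_ + _); apply: (pres_relE (Sym2_relZ _ _ _)).
Qed.

Lemma sym2_linearr x : linear (sym2 x).
Proof. by move=> r y y'; rewrite !(sym2C x); apply: sym2_linearl. Qed.

Section Lift.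
Context (V : lmodType R) (f : M -> M -> V).
Context (f_linearl : forall y, linear (f^~ y)).
Context (f_sym : forall x y, f x y = f y x).

Lemma Sym2_lift_rel a b : Sym2_rel a b ->
  meval (fun u => f u.1 u.2) a = meval (fun u => f u.1 u.2) b.
Proof.
case=> [x y z|r x y|x y] /=; last exact: f_sym.
- exact: (linear_morphD (f_linearl z)).
- exact: (linear_morphZ (f_linearl y)).
Qed.

Definition Sym2_lift : {linear Sym2 -> V} := pres_lift Sym2_lift_rel.

Lemma Sym2_liftE x y : Sym2_lift (sym2 x y) = f x y.
Proof. exact: pres_liftE. Qed.

End Lift.

Lemma Sym2_ext (V : lmodType R) (f g : {linear Sym2 -> V}) :
  (forall x y, f (sym2 x y) = g (sym2 x y)) -> f =1 g.
Proof. by move=> fg; apply: pres_ext => -[x y]; apply: fg. Qed.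

End Sym2.

Section Sym2Map.
Context (R : comPzRingType) (M N : lmodType R) (f : {linear M -> N}).

Lemma Sym2_map_linearl y : linear (fun x => sym2 (f x) (f y)).
Proof. by move=> r x x'; rewrite linearP; apply: sym2_linearl. Qed.

Definition Sym2_map : {linear Sym2 M -> Sym2 N} :=
  Sym2_lift Sym2_map_linearl (fun x y => sym2C (f x) (f y)).

Lemma Sym2_mapE x y : Sym2_map (sym2 x y) = sym2 (f x) (f y).
Proof. exact: Sym2_liftE. Qed.

End Sym2Map.

Section Gamma2.
Context (R : comPzRingType) (M : lmodType R).

(* Gamma2_sq x stands for gamma_2(x), Gamma2_mul x y for gamma_1(x) gamma_1(y). *)
Inductive Gamma2_gen : Type := Gamma2_sq of M | Gamma2_mul of M & M.

Notation g2 x := (MGen (Gamma2_sq x%R)).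
Notation g11 x y := (MGen (Gamma2_mul x%R y%R)).

Inductive Gamma2_rel : mexpr R Gamma2_gen -> mexpr R Gamma2_gen -> Prop :=
| Gamma2_relDl x x' y : Gamma2_rel (g11 (x + x') y) (g11 x y + g11 x' y)
| Gamma2_relZl r x y : Gamma2_rel (g11 (r *: x) y) (r *: g11 x y)
| Gamma2_relDr x y y' : Gamma2_rel (g11 x (y + y')) (g11 x y + g11 x y')
| Gamma2_relZr r x y : Gamma2_rel (g11 x (r *: y)) (r *: g11 x y)
| Gamma2_rel_sqD x y : Gamma2_rel (g2 (x + y)) (g2 x + g2 y + g11 x y)
| Gamma2_rel_sqZ r x : Gamma2_rel (g2 (r *: x)) (r ^+ 2 *: g2 x).

Definition Gamma2 := pres Gamma2_rel.
HB.instance Definition _ := GRing.Lmodule.on Gamma2.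

Definition gamma2 (x : M) : Gamma2 := pres_gen Gamma2_rel (Gamma2_sq x).
Definition gamma11 (x y : M) : Gamma2 := pres_gen Gamma2_rel (Gamma2_mul x y).

Lemma gamma2D x y : gamma2 (x + y) = gamma2 x + gamma2 y + gamma11 x y.
Proof. exact: (pres_relE (Gamma2_rel_sqD x y)). Qed.

Lemma gamma2Z r x : gamma2 (r *: x) = r ^+ 2 *: gamma2 x.
Proof. exact: (pres_relE (Gamma2_rel_sqZ r x)). Qed.

Lemma gamma11C x y : gamma11 x y = gamma11 y x.
Proof.
apply: (addrI (gamma2 x + gamma2 y)).
by rewrite -gamma2D [x + y]addrC gamma2D [gamma2 y + _]addrC.
Qed.

Lemma gamma11_linearl y : linear (gamma11^~ y).
Proof.
move=> r x x'; apply: etrans (pres_relE (Gamma2_relDl _ _ _)) _.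
by congr (_ + _); apply: (pres_relE (Gamma2_relZl _ _ _)).
Qed.

Lemma gamma11_linearr x : linear (gamma11 x).
Proof. by move=> r y y'; rewrite !(gamma11C x); apply: gamma11_linearl. Qed.

Section Lift.
Context (V : lmodType R) (f : M -> V) (b : M -> M -> V).
Context (b_linearl : forall y, linear (b^~ y)).
Context (b_linearr : forall x, linear (b x)).
Context (fD : forall x y, f (x + y) = f x + f y + b x y).
Context (fZ : forall r x, f (r *: x) = r ^+ 2 *: f x).

Definition Gamma2_gen_map (u : Gamma2_gen) : V :=
  match u with Gamma2_sq x => f x | Gamma2_mul x y => b x y end.

Lemma Gamma2_lift_rel u v : Gamma2_rel u v ->
  meval Gamma2_gen_map u = meval Gamma2_gen_map v.
Proof.
case=> [x x' y|r x y|x y y'|r x y|x y|r x] /=.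
- exact: (linear_morphD (b_linearl y)).
- exact: (linear_morphZ (b_linearl y)).
- exact: (linear_morphD (b_linearr x)).
- exact: (linear_morphZ (b_linearr x)).
- exact: fD.
- exact: fZ.
Qed.

Definition Gamma2_lift : {linear Gamma2 -> V} := pres_lift Gamma2_lift_rel.

Lemma Gamma2_lift_sq x : Gamma2_lift (gamma2 x) = f x.
Proof. exact: pres_liftE. Qed.

Lemma Gamma2_lift_mul x y : Gamma2_lift (gamma11 x y) = b x y.
Proof. exact: pres_liftE. Qed.

End Lift.

Lemma Gamma2_ext (V : lmodType R) (f g : {linear Gamma2 -> V}) :
  (forall x, f (gamma2 x) = g (gamma2 x)) -> f =1 g.
Proof.
move=> fg; apply: pres_ext => -[x|x y]; first exact: fg.
have gamma11E : pres_gen Gamma2_rel (Gamma2_mul x y) =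
    gamma2 (x + y) - (gamma2 x + gamma2 y) by rewrite gamma2D addrC addKr.
by rewrite gamma11E !(linearB, linearD) !fg.
Qed.

End Gamma2.

Section Gamma2Map.
Context (R : comPzRingType) (M N : lmodType R) (f : {linear M -> N}).

Lemma Gamma2_map_linearl y : linear (fun x => gamma11 (f x) (f y)).
Proof. by move=> r x x'; rewrite linearP; apply: gamma11_linearl. Qed.

Lemma Gamma2_map_linearr x : linear (fun y => gamma11 (f x) (f y)).
Proof. by move=> r y y'; rewrite linearP; apply: gamma11_linearr. Qed.

Lemma Gamma2_map_sqD x y :
  gamma2 (f (x + y)) = gamma2 (f x) + gamma2 (f y) + gamma11 (f x) (f y).
Proof. by rewrite linearD gamma2D. Qed.

Lemma Gamma2_map_sqZ r x : gamma2 (f (r *: x)) = r ^+ 2 *: gamma2 (f x).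
Proof. by rewrite linearZ gamma2Z. Qed.

Definition Gamma2_map : {linear Gamma2 M -> Gamma2 N} :=
  Gamma2_lift Gamma2_map_linearl Gamma2_map_linearr
    Gamma2_map_sqD Gamma2_map_sqZ.

Lemma Gamma2_mapE x : Gamma2_map (gamma2 x) = gamma2 (f x).
Proof. exact: Gamma2_lift_sq. Qed.

End Gamma2Map.

Section I2.
Context (R : comPzRingType).

(* The ideal generated by the r ^+ 2 - r, as an R-submodule of R. *)
Definition I2_pred : {pred R^o} := fun a =>
  `[< exists s : seq (R * R), a = \sum_(i <- s) i.1 * (i.2 ^+ 2 - i.2) >].

Lemma I2_submod_closed : submod_closed I2_pred.
Proof.
split=> [|r a b].
  by apply/asboolP; exists [::]; rewrite big_nil.
move=> /asboolP[s ->] /asboolP[t ->]; apply/asboolP.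
exists ([seq (r * i.1, i.2) | i <- s] ++ t).
rewrite big_cat big_map /=; congr (_ + _).
by rewrite [LHS]mulr_sumr; apply: eq_bigr => i _; rewrite mulrA.
Qed.

HB.instance Definition _ :=
  GRing.isSubmodClosed.Build R R^o I2_pred I2_submod_closed.

Record I2 := I2Sub { I2_val : R^o; I2_valP : I2_val \in I2_pred }.

HB.instance Definition _ := [isSub for I2_val].
HB.instance Definition _ := [Choice of I2 by <:].
HB.instance Definition _ := [SubChoice_isSubLmodule of I2 by <:].

Lemma I2_gen_subproof (r : R) : r ^+ 2 - r \in I2_pred.
Proof. by apply/asboolP; exists [:: (1, r)]; rewrite big_seq1 mul1r. Qed.

Definition I2_gen (r : R) : I2 := I2Sub (I2_gen_subproof r).

Lemma I2_two_subproof : 2 \in I2_pred.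
Proof.
have -> : 2 = 2 ^+ 2 - 2 :> R by ring.
exact: I2_gen_subproof.
Qed.

Definition I2_two : I2 := I2Sub I2_two_subproof.

Lemma I2_two_gen : I2_two = I2_gen 2.
Proof. by apply: val_inj => /=; ring. Qed.

Lemma I2_genP (a : I2) :
  exists s : seq (R * R), a = \sum_(i <- s) i.1 *: I2_gen i.2.
Proof.
have /asboolP[s s_a] := I2_valP a.
exists s; apply: val_inj; rewrite raddf_sum /= s_a.
by apply: eq_bigr.
Qed.

Lemma I2_ext (V : lmodType R) (f g : {linear I2 -> V}) :
  (forall r, f (I2_gen r) = g (I2_gen r)) -> f =1 g.
Proof.
move=> fg a; have [s ->] := I2_genP a; rewrite !linear_sum.
by apply: eq_bigr => i _; rewrite !linearZ fg.
Qed.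

Section Lift.
Context (V : lmodType R) (f : R -> V).
Context (fD : forall r s, f (r + s) = f r + f s + (r * s) *: f 2).
Context (fM : forall r s, f (r * s) = r ^+ 2 *: f s + s *: f r).

Let f0 : f 0 = 0.
Proof. by have := fM 0 0; rewrite mulr0 expr0n /= !scale0r addr0. Qed.

Let f1 : f 1 = 0.
Proof.
have /eqP := fM 1 1; rewrite mulr1 expr1n !scale1r -{1}[f 1]addr0.
by rewrite (inj_eq (addrI _)) eq_sym => /eqP.
Qed.

Let fN1 : f (-1) = f 2.
Proof.
have := fD (-1) 1; rewrite addNr f0 f1 addr0 mulr1 scaleN1r => /esym/eqP.
by rewrite subr_eq0 => /eqP.
Qed.

Let f_swap r s : (r ^+ 2 - r) *: f s = (s ^+ 2 - s) *: f r.
Proof.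
have /eqP := fM r s; rewrite mulrC fM -subr_eq0 => /eqP e.
apply/eqP; rewrite -subr_eq0; apply/eqP; rewrite -oppr0 -[in RHS]e.
lmod_ring R.
Qed.

Let f_two r : (r ^+ 2 - r) *: f 2 = 2 *: f r.
Proof. by rewrite f_swap; lmod_ring R. Qed.

Let f_gen r : f (r ^+ 2 - r) = (r ^+ 2 - r - 1) *: f r.
Proof.
have fN : f (- r) = r ^+ 2 *: f 2 - f r.
  by rewrite -[- r]mulrN1 fM fN1 scaleN1r.
rewrite fD fN expr2 fM.
have -> : (r * r * - r) *: f 2 = - (r ^+ 2 *: f 2) - r *: ((r ^+ 2 - r) *: f 2).
  by lmod_ring R.
rewrite f_two; lmod_ring R.
Qed.

Let f_Zgen c r :
  f (c * (r ^+ 2 - r)) = ((c * (r ^+ 2 - r) - 1) * c) *: f r.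
Proof.
rewrite mulrC fM f_gen expr2 -scalerA f_swap; lmod_ring R.
Qed.

Let dsum (s : seq (R * R)) := \sum_(i <- s) i.1 * (i.2 ^+ 2 - i.2).
Let fsum (s : seq (R * R)) := \sum_(i <- s) i.1 *: f i.2.

Let fsum_swap r s : (r ^+ 2 - r) *: fsum s = dsum s *: f r.
Proof.
rewrite scaler_sumr scaler_suml; apply: eq_bigr => i _.
by rewrite scalerA mulrC -!scalerA f_swap.
Qed.

(* In I2 itself this reads d ^+ 2 - d = (d - 1) * d, with d = dsum s. *)
Let f_dsum s : f (dsum s) = (dsum s - 1) *: fsum s.
Proof.
elim: s => [|[c r] s IH]; first by rewrite /dsum /fsum !big_nil f0 scaler0.
have -> : dsum ((c, r) :: s) = c * (r ^+ 2 - r) + dsum s by rewrite /dsum big_cons.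
have -> : fsum ((c, r) :: s) = c *: f r + fsum s by rewrite /fsum big_cons.
rewrite fD IH f_Zgen.
have -> : (c * (r ^+ 2 - r) * dsum s) *: f 2
    = (c * dsum s) *: ((r ^+ 2 - r) *: f 2) by lmod_ring R.
have e := fsum_swap r s.
have -> : (c * (r ^+ 2 - r) + dsum s - 1) *: (c *: f r + fsum s)
    = ((c * (r ^+ 2 - r) + dsum s - 1) * c) *: f r + (dsum s - 1) *: fsum s
      + c *: ((r ^+ 2 - r) *: fsum s) by lmod_ring R.
rewrite f_two e; lmod_ring R.
Qed.

Let fsum_eq0 s : dsum s = 0 -> fsum s = 0.
Proof.
move=> s0; have := f_dsum s; rewrite s0 f0 sub0r scaleN1r => /esym/eqP.
by rewrite oppr_eq0 => /eqP.
Qed.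

Let fsum_eq s t : dsum s = dsum t -> fsum s = fsum t.
Proof.
move=> st; apply/eqP; rewrite -subr_eq0; apply/eqP.
have <- : fsum (s ++ [seq (- i.1, i.2) | i <- t]) = fsum s - fsum t.
  rewrite /fsum big_cat big_map /= -sumrN; congr (_ + _).
  by apply: eq_bigr => i _; rewrite scaleNr.
apply: fsum_eq0; rewrite /dsum big_cat big_map /= -[RHS](subrr (dsum s)) {2}st.
rewrite /dsum -sumrN; congr (_ + _).
by apply: eq_bigr => i _; rewrite mulNr.
Qed.

Let rep (a : I2) : seq (R * R) := sval (cid (asboolW (I2_valP a))).

Let repE (a : I2) : I2_val a = dsum (rep a).
Proof. by rewrite /rep; case: cid. Qed.

Definition I2_lift_fun (a : I2) : V :=
  \sum_(i <- sval (cid (asboolW (I2_valP a)))) i.1 *: f i.2.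

Lemma I2_lift_fun_eq a s :
  I2_val a = \sum_(i <- s) i.1 * (i.2 ^+ 2 - i.2) ->
  I2_lift_fun a = \sum_(i <- s) i.1 *: f i.2.
Proof. by move=> a_s; apply: fsum_eq; rewrite -repE. Qed.

Lemma I2_lift_linear : linear I2_lift_fun.
Proof.
move=> r a b.
rewrite (@I2_lift_fun_eq _ ([seq (r * i.1, i.2) | i <- rep a] ++ rep b)).
  rewrite big_cat big_map /= scaler_sumr; congr (_ + _).
  by apply: eq_bigr => i _; rewrite scalerA.
rewrite big_cat big_map /=.
transitivity (r * I2_val a + I2_val b); first by [].
rewrite !repE; congr (_ + _).
by rewrite mulr_sumr; apply: eq_bigr => i _; rewrite mulrA.
Qed.

HB.instance Definition _ :=
  GRing.isLinear.Build R I2 V *:%R I2_lift_fun I2_lift_linear.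

Definition I2_lift : {linear I2 -> V} :=
  locked (I2_lift_fun : {linear I2 -> V}).

Lemma I2_liftE r : I2_lift (I2_gen r) = f r.
Proof.
rewrite /I2_lift -lock.
by rewrite [LHS](@I2_lift_fun_eq _ [:: (1, r)]) big_seq1 /= ?scale1r ?mul1r.
Qed.

End Lift.

End I2.

Arguments I2_two {R}.

Section P2.
Context (R : comPzRingType) (M : lmodType R).

Notation p x := (MGen x%R).

Inductive P2_rel : mexpr R M -> mexpr R M -> Prop :=
| P2_rel_add x y z :
    P2_rel (p (x + y + z) - p (x + y) - p (y + z) - p (x + z)
            + p x + p y + p z) 0
| P2_rel_bilin r s x y :
    P2_rel (p (r *: x + s *: y) - p (r *: x) - p (s *: y)
            - (r * s) *: p (x + y) + (r * s) *: p x + (r * s) *: p y) 0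
| P2_rel_scale r s x :
    P2_rel (p ((r * s) *: x) - r ^+ 2 *: p (s *: x) - s *: p (r *: x)
            + (r ^+ 2 * s) *: p x) 0.

Definition P2 := pres P2_rel.
HB.instance Definition _ := GRing.Lmodule.on P2.

Definition P2_p (x : M) : P2 := pres_gen P2_rel x.

Lemma P2_pD3 x y z :
  P2_p (x + y + z) = P2_p (x + y) + P2_p (y + z) + P2_p (x + z)
                     - P2_p x - P2_p y - P2_p z.
Proof.
have e : P2_p (x + y + z) - P2_p (x + y) - P2_p (y + z) - P2_p (x + z)
    + P2_p x + P2_p y + P2_p z = 0 := pres_relE (P2_rel_add x y z).
by rewrite -[RHS]addr0 -e; lmod_ring R.
Qed.

Lemma P2_pDZ r s x y :
  P2_p (r *: x + s *: y) = P2_p (r *: x) + P2_p (s *: y)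
    + (r * s) *: (P2_p (x + y) - P2_p x - P2_p y).
Proof.
have e : P2_p (r *: x + s *: y) - P2_p (r *: x) - P2_p (s *: y)
    - (r * s) *: P2_p (x + y) + (r * s) *: P2_p x + (r * s) *: P2_p y = 0
  := pres_relE (P2_rel_bilin r s x y).
by rewrite -[RHS]addr0 -e; lmod_ring R.
Qed.

Lemma P2_pZ r s x :
  P2_p ((r * s) *: x) = r ^+ 2 *: P2_p (s *: x) + s *: P2_p (r *: x)
                        - (r ^+ 2 * s) *: P2_p x.
Proof.
have e : P2_p ((r * s) *: x) - r ^+ 2 *: P2_p (s *: x) - s *: P2_p (r *: x)
    + (r ^+ 2 * s) *: P2_p x = 0 := pres_relE (P2_rel_scale r s x).
by rewrite -[RHS]addr0 -e; lmod_ring R.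
Qed.

Section Lift.
Context (V : lmodType R) (f : M -> V).
Context (f_rel : forall a b, P2_rel a b -> meval f a = meval f b).

Definition P2_lift : {linear P2 -> V} := pres_lift f_rel.

Lemma P2_liftE x : P2_lift (P2_p x) = f x.
Proof. exact: pres_liftE. Qed.

End Lift.

Lemma P2_ext (V : lmodType R) (f g : {linear P2 -> V}) :
  (forall x, f (P2_p x) = g (P2_p x)) -> f =1 g.
Proof. exact: pres_ext. Qed.

Lemma eps_rel a b : P2_rel a b -> meval (@id M) a = meval (@id M) b.
Proof. by case=> * /=; lmod_ring R. Qed.

Definition eps : {linear P2 -> M} := P2_lift eps_rel.

Lemma epsE x : eps (P2_p x) = x.
Proof. exact: P2_liftE. Qed.

End P2.

Section P2Map.
Context (R : comPzRingType) (M N : lmodType R) (f : {linear M -> N}).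

Lemma P2_map_rel a b : P2_rel a b ->
  meval (fun x => P2_p (f x)) a = meval (fun x => P2_p (f x)) b.
Proof.
have fD x y : f (x + y) = f x + f y by apply: linearD.
have fZ r x : f (r *: x) = r *: f x by apply: linearZ.
case=> [x y z|r s x y|r s x] /=; rewrite !(fD, fZ).
- by rewrite P2_pD3; lmod_ring R.
- by rewrite P2_pDZ; lmod_ring R.
- by rewrite P2_pZ; lmod_ring R.
Qed.

Definition P2_map : {linear P2 M -> P2 N} := P2_lift P2_map_rel.

Lemma P2_mapE x : P2_map (P2_p x) = P2_p (f x).
Proof. exact: P2_liftE. Qed.

End P2Map.

Section K.
Context (R : comPzRingType) (M : lmodType R).

Lemma sym2_w_linearl y : linear (fun x => gamma11 x y : Gamma2 M).
Proof. exact: gamma11_linearl. Qed.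

Definition w : {linear Sym2 M -> Gamma2 M} :=
  Sym2_lift sym2_w_linearl (@gamma11C R M).

Lemma wE x y : w (sym2 x y) = gamma11 x y.
Proof. exact: Sym2_liftE. Qed.

Lemma j11_linearl (u : Sym2 M) : linear (fun a : I2 R => I2_val a *: u).
Proof. by move=> r a b; rewrite scalerA -scalerDl. Qed.

Lemma j11_linearr (a : I2 R) : linear (fun u : Sym2 M => I2_val a *: u).
Proof. by move=> r u v; lmod_ring R. Qed.

Definition j11 : {linear tens (I2 R) (Sym2 M) -> Sym2 M} :=
  tens_lift j11_linearl j11_linearr.

Lemma j11E a x y : j11 (tensor a (sym2 x y)) = I2_val a *: sym2 x y.
Proof. exact: tens_liftE. Qed.

Lemma j12_linearl y : linear (fun x : M => 2 *: sym2 x y).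
Proof. by move=> r x x'; rewrite sym2_linearl; lmod_ring R. Qed.

Lemma j12_linearr x : linear (fun y : M => 2 *: sym2 x y).
Proof. by move=> r y y'; rewrite sym2_linearr; lmod_ring R. Qed.

Lemma j12_sqD x y :
  sym2 (x + y) (x + y) = sym2 x x + sym2 y y + 2 *: sym2 x y :> Sym2 M.
Proof.
rewrite (linear_morphD (sym2_linearl _)) !(linear_morphD (sym2_linearr _)).
by rewrite (sym2C y x); lmod_ring R.
Qed.

Lemma j12_sqZ r x : sym2 (r *: x) (r *: x) = r ^+ 2 *: sym2 x x :> Sym2 M.
Proof.
rewrite (linear_morphZ (sym2_linearl _)) (linear_morphZ (sym2_linearr _)).
by lmod_ring R.
Qed.

Definition j12 : {linear Gamma2 M -> Sym2 M} :=
  Gamma2_lift j12_linearl j12_linearr j12_sqD j12_sqZ.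

Lemma j12E x : j12 (gamma2 x) = sym2 x x.
Proof. exact: Gamma2_lift_sq. Qed.

Definition j21 : {linear tens (I2 R) (Sym2 M) -> tens (I2 R) (Gamma2 M)} :=
  tens_map (@idfun (I2 R)) w.

Lemma j21E a x y : j21 (tensor a (sym2 x y)) = tensor a (gamma11 x y).
Proof. by rewrite [LHS]tens_mapE wE. Qed.

Definition j22_fun (u : Gamma2 M) : tens (I2 R) (Gamma2 M) := tensor I2_two u.

HB.instance Definition _ :=
  GRing.isLinear.Build R (Gamma2 M) (tens (I2 R) (Gamma2 M)) *:%R
    j22_fun (tensor_linearr I2_two).

Definition j22 : {linear Gamma2 M -> tens (I2 R) (Gamma2 M)} :=
  locked (j22_fun : {linear Gamma2 M -> tens (I2 R) (Gamma2 M)}).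

Lemma j22E x : j22 (gamma2 x) = tensor I2_two (gamma2 x).
Proof. by rewrite /j22 -lock. Qed.

Definition span := (tens (I2 R) (Sym2 M) * Gamma2 M)%type.
HB.instance Definition _ := GRing.Lmodule.on span.

Definition j1_fun (u : span) : Sym2 M := j11 u.1 + j12 u.2.
Definition j2_fun (u : span) : tens (I2 R) (Gamma2 M) := j21 u.1 + j22 u.2.

Lemma j1_linear : linear j1_fun.
Proof. by move=> r u v; rewrite /j1_fun !linearP; lmod_ring R. Qed.

Lemma j2_linear : linear j2_fun.
Proof. by move=> r u v; rewrite /j2_fun !linearP; lmod_ring R. Qed.

HB.instance Definition _ :=
  GRing.isLinear.Build R span (Sym2 M) *:%R j1_fun j1_linear.
HB.instance Definition _ :=
  GRing.isLinear.Build R span (tens (I2 R) (Gamma2 M)) *:%R j2_fun j2_linear.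

Definition j1 : {linear span -> Sym2 M} :=
  locked (j1_fun : {linear span -> Sym2 M}).
Definition j2 : {linear span -> tens (I2 R) (Gamma2 M)} :=
  locked (j2_fun : {linear span -> tens (I2 R) (Gamma2 M)}).

Lemma j1E u : j1 u = j11 u.1 + j12 u.2.
Proof. by rewrite /j1 -lock. Qed.

Lemma j2E u : j2 u = j21 u.1 + j22 u.2.
Proof. by rewrite /j2 -lock. Qed.

Definition K := pushout j1 j2.
HB.instance Definition _ := GRing.Lmodule.on K.

Definition theta1 : {linear Sym2 M -> K} := pushout_inl j1 j2.
Definition theta2 : {linear tens (I2 R) (Gamma2 M) -> K} := pushout_inr j1 j2.

Definition beta (x y : M) : P2 M := P2_p (x + y) - P2_p x - P2_p y.

Lemma betaC x y : beta x y = beta y x.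
Proof. by rewrite /beta [y + x]addrC; lmod_ring R. Qed.

Lemma beta_linearl y : linear (beta^~ y).
Proof.
move=> r x x'; rewrite /beta P2_pD3.
have p0 : P2_p 0 = 0 :> P2 M.
  have := P2_pDZ 0 0 0 y; rewrite mul0r !scale0r addr0 addr0 => /eqP.
  by rewrite -{1}[P2_p 0]addr0 (inj_eq (addrI _)) eq_sym => /eqP.
have := P2_pDZ r 1 x y; rewrite !scale1r mulr1 => ->; lmod_ring R.
Qed.

Definition phi1 : {linear Sym2 M -> P2 M} := Sym2_lift beta_linearl betaC.

Lemma phi1E x y : phi1 (sym2 x y) = P2_p (x + y) - P2_p x - P2_p y.
Proof. exact: Sym2_liftE. Qed.

Lemma beta_linearr x : linear (beta x).
Proof. by move=> r y y'; rewrite !(betaC x); apply: beta_linearl. Qed.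

Definition dp (x : M) (r : R) : P2 M := P2_p (r *: x) - r *: P2_p x.

Lemma dp_two x : dp x 2 = beta x x.
Proof.
rewrite /dp /beta; have -> : 2 *: x = x + x by lmod_ring R.
lmod_ring R.
Qed.

Lemma dpD x r s : dp x (r + s) = dp x r + dp x s + (r * s) *: dp x 2.
Proof. by rewrite dp_two /dp /beta scalerDl P2_pDZ; lmod_ring R. Qed.

Lemma dpM x r s : dp x (r * s) = r ^+ 2 *: dp x s + s *: dp x r.
Proof. by rewrite /dp P2_pZ; lmod_ring R. Qed.

Definition dp_lift (x : M) : {linear I2 R -> P2 M} := I2_lift (dpD x) (dpM x).

Lemma dp_liftE x r : dp_lift x (I2_gen r) = dp x r.
Proof. exact: I2_liftE. Qed.

Section FixI2.
Context (a : I2 R).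

Lemma phi2_linearl y : linear (fun x => I2_val a *: beta x y).
Proof. by move=> r x x'; rewrite beta_linearl; lmod_ring R. Qed.

Lemma phi2_linearr x : linear (fun y => I2_val a *: beta x y).
Proof. by move=> r y y'; rewrite beta_linearr; lmod_ring R. Qed.

Lemma I2_val_sum (s : seq (R * R)) :
  I2_val (\sum_(i <- s) i.1 *: I2_gen i.2)
  = \sum_(i <- s) i.1 * (i.2 ^+ 2 - i.2).
Proof. by rewrite -[I2_val _]/(val _) raddf_sum; apply: eq_bigr. Qed.

Lemma phi2_sqD x y :
  dp_lift (x + y) a = dp_lift x a + dp_lift y a + I2_val a *: beta x y.
Proof.
have [s ->] := I2_genP a; rewrite I2_val_sum !linear_sum scaler_suml -!big_split.
apply: eq_bigr => -[c r] _ /=; rewrite !linearZ /= !dp_liftE /dp.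
by rewrite (scalerDr r x) P2_pDZ /beta; lmod_ring R.
Qed.

Lemma phi2_sqZ r x : dp_lift (r *: x) a = r ^+ 2 *: dp_lift x a.
Proof.
have [s ->] := I2_genP a; rewrite !linear_sum.
apply: eq_bigr => -[c t] _ /=; rewrite !linearZ /= !dp_liftE /dp.
by rewrite (scalerA t) [t * r]mulrC P2_pZ; lmod_ring R.
Qed.

Definition phi2_at : {linear Gamma2 M -> P2 M} :=
  Gamma2_lift phi2_linearl phi2_linearr phi2_sqD phi2_sqZ.

End FixI2.

Lemma phi2_at_linear (u : Gamma2 M) : linear (phi2_at^~ u).
Proof.
move=> r a b.
pose f : {linear Gamma2 M -> P2 M} := (r \*: phi2_at a) \+ phi2_at b.
rewrite -[RHS]/(f u); apply: Gamma2_ext => x.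
by rewrite /f /= !Gamma2_lift_sq linearP.
Qed.

Definition phi2 : {linear tens (I2 R) (Gamma2 M) -> P2 M} :=
  tens_lift phi2_at_linear (fun a => linearP (phi2_at a)).

Lemma phi2E r x :
  phi2 (tensor (I2_gen r) (gamma2 x)) = P2_p (r *: x) - r *: P2_p x.
Proof. by rewrite [LHS]tens_liftE Gamma2_lift_sq dp_liftE. Qed.

Lemma phi_j11 u : phi1 (j11 u) = phi2 (j21 u).
Proof.
suff e : phi1 \o j11 =1 phi2 \o j21 by apply: e.
apply: tens_ext => a v /=.
rewrite tens_liftE linearZ tens_mapE tens_liftE /=.
pose f : {linear Sym2 M -> P2 M} := I2_val a \*: phi1.
suff e : f =1 phi2_at a \o w by apply: e.
by apply: Sym2_ext => x y; rewrite /f /= wE Gamma2_lift_mul [phi1 _]Sym2_liftE.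
Qed.

Lemma phi_j12 u : phi1 (j12 u) = phi2 (j22 u).
Proof.
suff e : phi1 \o j12 =1 phi2 \o j22 by apply: e.
apply: Gamma2_ext => x /=.
by rewrite j12E j22E I2_two_gen phi2E phi1E [RHS]dp_two.
Qed.

Lemma phi_glue u : phi1 (j1 u) = phi2 (j2 u).
Proof. by rewrite j1E j2E !linearD phi_j11 phi_j12. Qed.

Definition phi : {linear K -> P2 M} := pushout_lift phi_glue.

Lemma phi_theta1 u : phi (theta1 u) = phi1 u.
Proof. exact: pushout_lift_inl. Qed.

Lemma phi_theta2 u : phi (theta2 u) = phi2 u.
Proof. exact: pushout_lift_inr. Qed.

Lemma theta1_j11 u : theta1 (j11 u) = theta2 (j21 u).
Proof.
have := pushout_glue j1 j2 (u, 0).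
by rewrite j1E j2E /= !linear0 !addr0.
Qed.

Lemma theta1_j12 u : theta1 (j12 u) = theta2 (j22 u).
Proof.
have := pushout_glue j1 j2 (0, u).
by rewrite j1E j2E /= !linear0 !add0r.
Qed.

End K.

Section KMap.
Context (R : comPzRingType) (M N : lmodType R) (f : {linear M -> N}).

Definition I2_Gamma2_map :
    {linear tens (I2 R) (Gamma2 M) -> tens (I2 R) (Gamma2 N)} :=
  tens_map (@idfun (I2 R)) (Gamma2_map f).

Lemma I2_Gamma2_mapE a u :
  I2_Gamma2_map (tensor a u) = tensor a (Gamma2_map f u).
Proof. exact: tens_mapE. Qed.

Lemma w_natural u : w N (Sym2_map f u) = Gamma2_map f (w M u).
Proof.
suff e : w N \o Sym2_map f =1 Gamma2_map f \o w M by apply: e.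
apply: Sym2_ext => x y /=.
by rewrite Sym2_mapE !wE [RHS]Gamma2_lift_mul.
Qed.

Lemma K_map_glue u :
  theta1 N (Sym2_map f (j1 M u)) = theta2 N (I2_Gamma2_map (j2 M u)).
Proof.
case: u => u v; rewrite j1E j2E !linearD /=; congr (_ + _).
  suff e : theta1 N \o Sym2_map f \o j11 M
      =1 theta2 N \o I2_Gamma2_map \o j21 M by apply: e.
  apply: tens_ext => a s /=.
  rewrite [j11 _ _]tens_liftE [j21 _ _]tens_mapE I2_Gamma2_mapE /= -w_natural.
  rewrite linearZ /= -[_ *: Sym2_map f s](tens_liftE (@j11_linearl _ N) (@j11_linearr _ N)).
  by rewrite [LHS]theta1_j11 [j21 _ _]tens_mapE.
suff e : theta1 N \o Sym2_map f \o j12 M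
    =1 theta2 N \o I2_Gamma2_map \o j22 M by apply: e.
apply: Gamma2_ext => x /=.
rewrite j12E j22E Sym2_mapE I2_Gamma2_mapE Gamma2_mapE.
by rewrite -j12E theta1_j12 j22E.
Qed.

Definition K_map : {linear K M -> K N} :=
  pushout_lift (h := theta1 N \o Sym2_map f) (k := theta2 N \o I2_Gamma2_map)
    K_map_glue.

Lemma K_map_theta1 u : K_map (theta1 M u) = theta1 N (Sym2_map f u).
Proof. exact: pushout_lift_inl. Qed.

Lemma K_map_theta2 u : K_map (theta2 M u) = theta2 N (I2_Gamma2_map u).
Proof. exact: pushout_lift_inr. Qed.

End KMap.

Section Functoriality.
Context (R : comPzRingType).

Lemma P2_map_id (M : lmodType R) : P2_map (@idfun M) =1 id.
Proof.
suff e : P2_map (@idfun M) =1 @idfun (P2 M) by [].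
by apply: P2_ext => x; rewrite P2_mapE.
Qed.

Lemma P2_map_comp (L M N : lmodType R) (g : {linear M -> N})
    (f : {linear L -> M}) : P2_map (g \o f) =1 P2_map g \o P2_map f.
Proof. by apply: P2_ext => x /=; rewrite !P2_mapE. Qed.

Lemma K_map_id (M : lmodType R) : K_map (@idfun M) =1 id.
Proof.
suff e : K_map (@idfun M) =1 @idfun (K M) by [].
apply: pushout_ext => u.
  rewrite [LHS]K_map_theta1 /=; congr (theta1 M _).
  suff e : Sym2_map (@idfun M) =1 @idfun (Sym2 M) by apply: e.
  by apply: Sym2_ext => x y; rewrite Sym2_mapE.
rewrite [LHS]K_map_theta2 /=; congr (theta2 M _).
suff e : I2_Gamma2_map (@idfun M) =1 @idfun (tens (I2 R) (Gamma2 M)).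
  exact: e.
apply: tens_ext => a v; rewrite I2_Gamma2_mapE /=; congr (tensor a _).
suff e : Gamma2_map (@idfun M) =1 @idfun (Gamma2 M) by apply: e.
by apply: Gamma2_ext => x; rewrite Gamma2_mapE.
Qed.

Lemma K_map_comp (L M N : lmodType R) (g : {linear M -> N})
    (f : {linear L -> M}) : K_map (g \o f) =1 K_map g \o K_map f.
Proof.
apply: pushout_ext => u /=.
  rewrite [LHS]K_map_theta1 [K_map f _]K_map_theta1 [RHS]K_map_theta1.
  congr (theta1 N _).
  suff e : Sym2_map (g \o f) =1 Sym2_map g \o Sym2_map f by apply: e.
  by apply: Sym2_ext => x y /=; rewrite !Sym2_mapE.
rewrite [LHS]K_map_theta2 [K_map f _]K_map_theta2 [RHS]K_map_theta2.
congr (theta2 N _).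
suff e : I2_Gamma2_map (g \o f) =1 I2_Gamma2_map g \o I2_Gamma2_map f.
  exact: e.
apply: tens_ext => a v /=; rewrite !I2_Gamma2_mapE; congr (tensor a _).
suff e : Gamma2_map (g \o f) =1 Gamma2_map g \o Gamma2_map f by apply: e.
by apply: Gamma2_ext => x /=; rewrite !Gamma2_mapE.
Qed.

End Functoriality.

Definition short_exact (R : comPzRingType) (A B C : lmodType R)
    (f : {linear A -> B}) (g : {linear B -> C}) : Prop :=
  [/\ injective f,
      forall b, g b = 0 <-> exists a, f a = b
    & forall c, exists b, g b = c].

Section Extension.
Context (R : comPzRingType) (M : lmodType R).

(* Not to be confused with the direct sum of K M and M, which is the module  *)
(* structure that canonical inference finds on the same carrier.             *)
Definition ext_carrier : Type := (K M * M)%type.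
HB.instance Definition _ := Choice.copy ext_carrier (K M * M)%type.

Definition ext_add (u v : ext_carrier) : ext_carrier :=
  (u.1 + v.1 - theta1 M (sym2 u.2 v.2), u.2 + v.2).

Definition ext_scale (r : R) (u : ext_carrier) : ext_carrier :=
  (r *: u.1 - theta2 M (tensor (I2_gen r) (gamma2 u.2)), r *: u.2).

End Extension.

(* Main.v *)
Require Import Defs.
From HB Require Import structures.
From mathcomp Require Import all_boot all_order all_algebra.
From mathcomp Require Import ring.

Set Implicit Arguments.
Unset Strict Implicit.
Unset Printing Implicit Defensive.

Import GRing.Theory.
Local Open Scope ring_scope.

(** Every element of [P2 M] has the form [phi k + P2_p x]: the cross effect
    of [p] at [x, y] is [phi (theta1 (xy))], and the failure of [p] to commute
    with multiplication by [r] on [x] is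
    [phi (theta2 (tensor (I2_gen r) (gamma2 x)))].
    So [P2 M] is an extension of [M] by a quotient of [K M], with [p] as a
    set-theoretic section and these two elements as its cocycle.  The point is
    that the same cocycle already defines a module on [K M * M].  Bilinearity
    and symmetry of [xy] give the additive group.  Compatibility with products
    in [R] comes from [gamma2Z] and from [I2_genM], a twisted Leibniz rule for
    [r^2 - r].  The two distributive laws are the two gluing relations of the
    pushout: [j11] for sums in the module ([scale_cocycleDr]), [j12] for sums
    of scalars ([scale_cocycleDl]).

    In that module [x |-> (0, x)] satisfies the defining relations of [P2 M]
    because its additive defect is bilinear and its scalar defect obeys the
    twisted Leibniz rule ([ext_section_rel]).  The resulting linear map
    [P2_to_ext] is inverse to [(k, x) |-> phi k + P2_p x], and sends [phi k]
    to [(k, 0)].  The latter makes [phi] injective, and surjectivity of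
    [(k, x) |-> phi k + P2_p x] identifies the kernel of [eps] with the image
    of [phi]. *)

(** * The cocycle of the extension *)

Section Cocycle.
Context (R : comPzRingType).

Lemma I2_gen1 : I2_gen 1 = 0 :> I2 R.
Proof. by apply: val_inj => /=; ring. Qed.

(** The other expansion, [r ^+ 2 *: I2_gen s + s *: I2_gen r], is this one with
    [r] and [s] exchanged: both patterns occur, the first in associativity of
    the scalar action, the second in the relations of [P2 M]. *)
Lemma I2_genM (r s : R) : I2_gen (r * s) = r *: I2_gen s + s ^+ 2 *: I2_gen r.
Proof. by apply: val_inj; rewrite /= /GRing.scale /=; ring. Qed.

Lemma I2_genD (r s : R) :
  I2_gen (r + s) = I2_gen r + I2_gen s + (r * s) *: I2_two.
Proof. by apply: val_inj; rewrite /= /GRing.scale /=; ring. Qed.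

Section PureTensors.
Context (A B V : lmodType R) (h : {linear tens A B -> V}).

Lemma pure_linearl b : linear (fun a => h (tensor a b)).
Proof. by move=> r a a'; rewrite (tensor_linearl b) linearP. Qed.

Lemma pure_linearr a : linear (fun b => h (tensor a b)).
Proof. by move=> r b b'; rewrite (tensor_linearr a) linearP. Qed.

(** Fixing one factor of a pure tensor, as bundled maps, so that the
    extensionality principle of the other factor applies. *)
Definition pure_left (b : B) : {linear A -> V} :=
  HB.pack (fun a => h (tensor a b))
    (GRing.isLinear.Build R A V *:%R _ (pure_linearl b)).

Definition pure_right (a : A) : {linear B -> V} :=
  HB.pack (fun b => h (tensor a b))
    (GRing.isLinear.Build R B V *:%R _ (pure_linearr a)).

End PureTensors.

(** The tensors with both factors among the standard generators span; in
    particular the products [gamma11 x y] need not be tested. *)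
Lemma I2_Gamma2_ext (M V : lmodType R)
    (f g : {linear tens (I2 R) (Gamma2 M) -> V}) :
  (forall r x, f (tensor (I2_gen r) (gamma2 x))
             = g (tensor (I2_gen r) (gamma2 x))) -> f =1 g.
Proof.
move=> fg; apply: tens_ext => a u.
apply: (@I2_ext _ _ (pure_left f u) (pure_left g u)) => r.
by apply: (@Gamma2_ext _ _ _ (pure_right f _) (pure_right g _)) => x; apply: fg.
Qed.

Context (M : lmodType R).

Definition add_cocycle (x y : M) : K M := theta1 M (sym2 x y).
Definition scale_cocycle (r : R) (x : M) : K M :=
  theta2 M (tensor (I2_gen r) (gamma2 x)).

Lemma add_cocycleC x y : add_cocycle x y = add_cocycle y x.
Proof. by rewrite /add_cocycle sym2C. Qed.

Lemma add_cocycle_linearl y : linear (add_cocycle^~ y).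
Proof. by move=> r x x'; rewrite /add_cocycle sym2_linearl linearP. Qed.

Lemma add_cocycle_linearr x : linear (add_cocycle x).
Proof. by move=> r y y'; rewrite !(add_cocycleC x) add_cocycle_linearl. Qed.

Definition add_cocycleDl y := linear_morphD (add_cocycle_linearl y).
Definition add_cocycleDr x := linear_morphD (add_cocycle_linearr x).
Definition add_cocycleZl y := linear_morphZ (add_cocycle_linearl y).
Definition add_cocycleZr x := linear_morphZ (add_cocycle_linearr x).

Lemma scale_cocycle1 x : scale_cocycle 1 x = 0.
Proof.
by rewrite /scale_cocycle I2_gen1; apply: (linear0 (pure_left (theta2 M) _)).
Qed.

Lemma scale_cocycleM r s x :
  scale_cocycle (r * s) x = r *: scale_cocycle s x + scale_cocycle r (s *: x).
Proof.
rewrite /scale_cocycle I2_genM gamma2Z tensor_linearl.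
rewrite (linear_morphZ (tensor_linearl _)) (linear_morphZ (tensor_linearr _)).
by rewrite linearP.
Qed.

Lemma scale_cocycleZ r s x :
  scale_cocycle r (s *: x) = s ^+ 2 *: scale_cocycle r x.
Proof.
by rewrite /scale_cocycle gamma2Z (linear_morphZ (tensor_linearr _)) linearZ.
Qed.

(** The gluing along [j12], which identifies [x^2] with [2 (x) gamma2 x]. *)
Lemma scale_cocycleDl r s x :
  scale_cocycle (r + s) x
  = scale_cocycle r x + scale_cocycle s x + (r * s) *: add_cocycle x x.
Proof.
rewrite /scale_cocycle /add_cocycle -j12E theta1_j12 j22E I2_genD.
rewrite !(linear_morphD (tensor_linearl _)) (linear_morphZ (tensor_linearl _)).
by rewrite !linearD linearZ.
Qed.

(** The gluing along [j11], which identifies [a (x) gamma11 x y] with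
    [a *: xy]. *)
Lemma scale_cocycleDr r x y :
  scale_cocycle r (x + y)
  = scale_cocycle r x + scale_cocycle r y
    + (r ^+ 2 - r) *: add_cocycle x y.
Proof.
rewrite /scale_cocycle /add_cocycle gamma2D !(linear_morphD (tensor_linearr _)).
rewrite !linearD; congr (_ + _).
by rewrite -linearZ -[_ *: sym2 x y](j11E (I2_gen r)) theta1_j11 j21E.
Qed.

End Cocycle.

(** * The module defined by the cocycle, and its comparison with P2 *)

Section ExtensionModule.
Context (R : comPzRingType) (M : lmodType R).

Implicit Types (u v : ext_carrier M) (x y : M) (k : K M).

Definition ext_zero : ext_carrier M := (0, 0).
(** The correction by [xx] compensates the cocycle of [x] and [- x]. *)
Definition ext_opp u : ext_carrier M := (- u.1 - add_cocycle u.2 u.2, - u.2).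

Lemma ext_addA : associative (@ext_add R M).
Proof.
move=> [k x] [k' y] [k'' z]; congr (_, _); rewrite /= ?addrA //.
rewrite -!/(add_cocycle _ _) add_cocycleDl add_cocycleDr; lmod_ring R.
Qed.

Lemma ext_addC : commutative (@ext_add R M).
Proof.
move=> [k x] [k' y]; congr (_, _); rewrite /= 1?addrC //.
by rewrite sym2C [k + k']addrC addrC.
Qed.

Lemma ext_add0 : left_id ext_zero (@ext_add R M).
Proof.
move=> [k x]; congr (_, _); rewrite /= add0r // -/(add_cocycle _ _).
by rewrite -(scale0r (0 : M)) add_cocycleZl; lmod_ring R.
Qed.

Lemma ext_addN : left_inverse ext_zero ext_opp (@ext_add R M).
Proof.
move=> [k x]; congr (_, _); rewrite /= ?addNr // -/(add_cocycle _ _).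
by rewrite -(scaleN1r x) add_cocycleZl; lmod_ring R.
Qed.

HB.instance Definition _ :=
  GRing.isZmodule.Build (ext_carrier M) ext_addA ext_addC ext_add0 ext_addN.

Lemma ext_scaleA r s u : ext_scale r (ext_scale s u) = ext_scale (r * s) u.
Proof.
case: u => k x; congr (_, _); rewrite /= ?scalerA //.
by rewrite -!/(scale_cocycle _ _) scale_cocycleM; lmod_ring R.
Qed.

Lemma ext_scale1 : left_id 1 (@ext_scale R M).
Proof.
move=> [k x]; congr (_, _); rewrite /= scale1r //.
by rewrite -/(scale_cocycle _ _) scale_cocycle1 subr0.
Qed.

Lemma ext_scaleDr : right_distributive (@ext_scale R M) +%R.
Proof.
move=> r [k x] [k' y]; congr (_, _); rewrite /= ?scalerDr //.
rewrite -!/(scale_cocycle _ _) -!/(add_cocycle _ _).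
by rewrite scale_cocycleDr add_cocycleZl add_cocycleZr; lmod_ring R.
Qed.

Lemma ext_scaleDl u : {morph (@ext_scale R M)^~ u : r s / r + s}.
Proof.
case: u => k x r s; congr (_, _); rewrite /= ?scalerDl //.
rewrite -!/(scale_cocycle _ _) -!/(add_cocycle _ _).
by rewrite scale_cocycleDl add_cocycleZl add_cocycleZr; lmod_ring R.
Qed.

HB.instance Definition _ := GRing.Zmodule_isLmodule.Build R (ext_carrier M)
  ext_scaleA ext_scale1 ext_scaleDr ext_scaleDl.

Definition ext_inl k : ext_carrier M := (k, 0).
Definition ext_section x : ext_carrier M := (0, x).

Lemma ext_addE u v : u + v = ext_add u v. Proof. by []. Qed.
Lemma ext_scaleE r u : r *: u = ext_scale r u. Proof. by []. Qed.

Lemma add_cocycle0 x : add_cocycle x 0 = 0.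
Proof. by rewrite -(scale0r (0 : M)) add_cocycleZr scale0r. Qed.

Lemma ext_inl_linear : linear ext_inl.
Proof.
move=> r k k'; rewrite ext_addE ext_scaleE.
congr (_, _); rewrite /= scaler0 ?addr0 //.
rewrite -/(scale_cocycle _ _) -/(add_cocycle _ _) add_cocycle0.
by rewrite -(scale0r (0 : M)) scale_cocycleZ; lmod_ring R.
Qed.

HB.instance Definition _ :=
  GRing.isLinear.Build R (K M) (ext_carrier M) *:%R ext_inl ext_inl_linear.

Lemma ext_split k x : (k, x) = ext_inl k + ext_section x.
Proof.
rewrite ext_addE; congr (_, _); rewrite /= ?add0r //.
by rewrite sym2C -/(add_cocycle _ _) add_cocycle0 subr0 addr0.
Qed.

Lemma ext_sectionD x y :
  ext_section (x + y)
  = ext_section x + ext_section y + ext_inl (add_cocycle x y).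
Proof.
rewrite !ext_addE; congr (_, _); rewrite /= ?addr0 //.
rewrite -!/(add_cocycle _ _) add_cocycle0; lmod_ring R.
Qed.

Lemma ext_sectionZ r x :
  ext_section (r *: x) = r *: ext_section x + ext_inl (scale_cocycle r x).
Proof.
rewrite ext_addE ext_scaleE; congr (_, _); rewrite /= ?addr0 //.
rewrite -!/(add_cocycle _ _) add_cocycle0 -/(scale_cocycle _ _); lmod_ring R.
Qed.

(** Once the section is expanded by its two defects, each relation of [P2 M]
    compares coefficients of the sections of [x], [y], [z] and of finitely many
    cocycle values. *)
Lemma ext_section_rel a b :
  P2_rel a b -> meval ext_section a = meval ext_section b.
Proof.
have inlD k k' : ext_inl (k + k') = ext_inl k + ext_inl k' by apply: linearD.
have inlZ r k : ext_inl (r *: k) = r *: ext_inl k by apply: linearZ.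
case=> [x y z|r s x y|r s x] /=.
- by rewrite !(ext_sectionD, add_cocycleDl, inlD); lmod_ring R.
- rewrite !(ext_sectionD, ext_sectionZ, add_cocycleZl, add_cocycleZr, inlZ).
  lmod_ring R.
(* The relation has r ^+ 2 on p (s x), whereas scale_cocycleM puts the square
   on the second factor. *)
- rewrite [r * s]mulrC.
  rewrite !(ext_sectionZ, scale_cocycleM, scale_cocycleZ, inlD, inlZ).
  lmod_ring R.
Qed.

Definition P2_to_ext : {linear P2 M -> ext_carrier M} :=
  P2_lift ext_section_rel.

Lemma P2_to_extE x : P2_to_ext (P2_p x) = ext_section x.
Proof. exact: P2_liftE. Qed.

(** This carries the injectivity of [phi]: on generators of [K M] it says that
    [p] in [P2 M] and the section [x |-> (0, x)] have the same defects. *)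
Lemma P2_to_ext_phi k : P2_to_ext (phi M k) = ext_inl k.
Proof.
suff e : P2_to_ext \o phi M =1 (ext_inl : {linear K M -> ext_carrier M}).
  exact: e.
apply: pushout_ext => v.
  suff e : P2_to_ext \o phi M \o theta1 M
      =1 (ext_inl : {linear K M -> ext_carrier M}) \o theta1 M by apply: e.
  apply: Sym2_ext => x y /=.
  rewrite phi_theta1 phi1E !linearB /= !P2_to_extE ext_sectionD.
  rewrite -/(add_cocycle _ _); lmod_ring R.
suff e : P2_to_ext \o phi M \o theta2 M
    =1 (ext_inl : {linear K M -> ext_carrier M}) \o theta2 M by apply: e.
apply: I2_Gamma2_ext => r x /=.
rewrite phi_theta2 phi2E linearB linearZ /= !P2_to_extE ext_sectionZ.
rewrite -/(scale_cocycle _ _); lmod_ring R.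
Qed.

Definition ext_to_P2 u : P2 M := phi M u.1 + P2_p u.2.

Lemma ext_to_P2_linear : linear ext_to_P2.
Proof.
move=> r [k x] [k' y]; rewrite ext_addE ext_scaleE /ext_to_P2 /=.
rewrite !(linearB, linearD, linearZ) /= phi_theta1 phi_theta2 phi1E phi2E.
lmod_ring R.
Qed.

HB.instance Definition _ :=
  GRing.isLinear.Build R (ext_carrier M) (P2 M) *:%R
    ext_to_P2 ext_to_P2_linear.

Lemma P2_to_extK : cancel P2_to_ext ext_to_P2.
Proof.
suff e : (ext_to_P2 : {linear ext_carrier M -> P2 M}) \o P2_to_ext
    =1 @idfun (P2 M) by apply: e.
by apply: P2_ext => x; rewrite /= P2_to_extE /ext_to_P2 /= linear0 add0r.
Qed.

Lemma ext_to_P2K : cancel ext_to_P2 P2_to_ext.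
Proof.
move=> [k x]; rewrite /ext_to_P2 linearD /= P2_to_ext_phi P2_to_extE.
by rewrite -ext_split.
Qed.

Lemma eps_phi k : eps M (phi M k) = 0.
Proof.
suff e : eps M \o phi M =1 (\0 : {linear K M -> M}) by apply: e.
apply: pushout_ext => v.
  suff e : eps M \o phi M \o theta1 M =1 (\0 : {linear Sym2 M -> M}).
    exact: e.
  apply: Sym2_ext => x y /=.
  by rewrite phi_theta1 phi1E !linearB /= !epsE; lmod_ring R.
suff e : eps M \o phi M \o theta2 M
    =1 (\0 : {linear tens (I2 R) (Gamma2 M) -> M}) by apply: e.
apply: I2_Gamma2_ext => r x /=.
by rewrite phi_theta2 phi2E linearB linearZ /= !epsE subrr.
Qed.

Lemma phi_eps_exact : short_exact (phi M) (eps M).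
Proof.
split=> [k k' kk'|b|x]; last by exists (P2_p x); rewrite epsE.
  by have := congr1 P2_to_ext kk'; rewrite !P2_to_ext_phi => -[].
split=> [|[k <-]]; last exact: eps_phi.
rewrite -(P2_to_extK b); case: (P2_to_ext b) => k x.
rewrite /ext_to_P2 linearD /= eps_phi epsE add0r => ->.
have p0 : P2_p 0 = 0 :> P2 M.
  by rewrite -(P2_to_extK (P2_p 0)) P2_to_extE linear0.
by exists k; rewrite p0 addr0.
Qed.

End ExtensionModule.

(** * Naturality *)

Lemma phi_natural (R : comPzRingType) (M N : lmodType R) (f : {linear M -> N})
    (k : K M) :
  P2_map f (phi M k) = phi N (K_map f k).
Proof.
suff e : P2_map f \o phi M =1 phi N \o K_map f by apply: e.
apply: pushout_ext => v /=.
  suff e : P2_map f \o phi M \o theta1 M =1 phi N \o K_map f \o theta1 M.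
    exact: e.
  apply: Sym2_ext => x y /=.
  rewrite K_map_theta1 !phi_theta1 Sym2_mapE !phi1E !linearB /= !P2_mapE.
  by rewrite linearD.
suff e : P2_map f \o phi M \o theta2 M =1 phi N \o K_map f \o theta2 M.
  exact: e.
apply: I2_Gamma2_ext => r x /=.
rewrite K_map_theta2 !phi_theta2 I2_Gamma2_mapE Gamma2_mapE !phi2E.
by rewrite linearB linearZ /= !P2_mapE linearZ.
Qed.

Lemma eps_natural (R : comPzRingType) (M N : lmodType R) (f : {linear M -> N})
    (u : P2 M) :
  f (eps M u) = eps N (P2_map f u).
Proof.
suff e : f \o eps M =1 eps N \o P2_map f by apply: e.
by apply: P2_ext => x /=; rewrite P2_mapE !epsE.
Qed.

Theorem theorem4p3 (R : comPzRingType) :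
  [/\ forall M : lmodType R, short_exact (phi M) (eps M),
      forall (M N : lmodType R) (f : {linear M -> N}),
        (forall k : K M, P2_map f (phi M k) = phi N (K_map f k)) /\
        (forall u : P2 M, f (eps M u) = eps N (P2_map f u))
    & forall M : lmodType R,
        exists E_class : GRing.Lmodule.axioms_ R (ext_carrier M),
          let E : lmodType R := GRing.Lmodule.Pack E_class in
          [/\ forall u v : E, u + v = ext_add u v,
              forall (r : R) (u : E), r *: u = ext_scale r u
            & exists Phi : {linear P2 M -> E},
                bijective Phi /\ forall x : M, Phi (P2_p x) = (0, x)]].
Proof.
split=> [M|M N f|M]; first exact: phi_eps_exact.
  by split; [apply: phi_natural|apply: eps_natural].
exists (GRing.Lmodule.class (ext_carrier M : lmodType R)) => E; split=> //.
exists (P2_to_ext M); split; last exact: P2_to_extE.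
by exists (@ext_to_P2 R M); [apply: P2_to_extK|apply: ext_to_P2K].
Qed.
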